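(* In the stochastic control setting described in the context, suppose that for every $s\ge 0$ the optimization problem $$\inf_{\varphi\in\Omega(s)}J(\varphi),\qquad \Omega(s)=\{\varphi\in S_{ad}: I(\varphi)\le s\},$$ has a solution (i.e. the infimum is attained by some $\varphi_s^\ast\in\Omega(s)$). Let $J_o=\inf_{\varphi\in\Omega(0)}J(\varphi)$ and let $J^\ast=J(\varphi^\ast)$ be the optimal cost over $S_{ad}$. Then there exists a non-decreasing, bounded function $\rho:[0,\infty)\to[0,J_o-J^\ast]$ with $\rho(0)=0$ such that $$J_o-J(\varphi)\le \rho(I(\varphi))\qquad\text{for all }\varphi\in S_{ad}.$$
   Context: System. Let $N\ge 1$ be the control horizon and consider the stochastic system $x_{k+1}=f(x_k,u_k,w_k)$, $y_k=h(x_k,v_k)$, $k=0,1,\dots$, with $x_k\in\mathbb{R}^n$, $y_k\in\mathbb{R}^m$, $w_k\in\mathbb{R}^{n_w}$, $v_k\in\mathbb{R}^{n_v}$, $u_k\in U_{ad}=\{u\in\mathbb{R}^r: u_{\min}\le u\le u_{\max}\}$ (elementwise inequalities; in some justified cases $U_{ad}=\mathbb{R}^r$ is also allowed). The functions $f,h$ are $C^2$ in all arguments; $w_k$ has density $p_w$, $v_k$ has density $p_v$, $x_0$ has density $p_0^-$, and $x_0,w_0,\dots,w_k,v_0,\dots,v_k$ are mutually independent for all $k$. Write $Y_k=\mathrm{col}(y_0,\dots,y_k)$, $X=\mathrm{col}(x_0,\dots,x_{N-1})$, $Y=\mathrm{col}(y_0,\dots,y_{N-1})$, $U=\mathrm{col}(u_0,\dots,u_{N-1})$.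 Strategies. An admissible strategy is a map $\varphi:\mathbb{R}^{mN}\to U_{ad}^N\subset\mathbb{R}^{Nr}$ of the form $\varphi(Y)=\mathrm{col}(\varphi_0(Y_0),\dots,\varphi_{N-1}(Y_{N-1}))$ with each $\varphi_k:\mathbb{R}^{m(k+1)}\to U_{ad}$ measurable; the control is $u_k=\varphi_k(Y_k)$, so $U=\varphi(Y)$. The set of all admissible strategies is $S_{ad}$; it is regarded as a subset of the Banach space of bounded maps $\mathbb{R}^{Nm}\to\mathbb{R}^{Nr}$ with norm $\|g\|=\sup_{Y}\|g(Y)\|_{\mathbb{R}^{Nr}}$. Cost. $L:\mathbb{R}^n\to\mathbb{R}$ is a measurable $C^2$ function and $J(\varphi)=E\{L(x_N)\mid\varphi\}$, the expectation being over $x_0,w_0,\dots,w_{N-1},v_0,\dots,v_{N-1}$ with strategy $\varphi$ applied. It is assumed that an optimal strategy $\varphi^\ast\in S_{ad}$ minimizing $J$ over $S_{ad}$ exists; $J^\ast=J(\varphi^\ast)$. Information. $I(\varphi)=H(X|\varphi)-H(X|U,\varphi)$ is the mutual information between $X$ and $U$ under the strategy $\varphi$, where $H(X|\varphi)=E(-\ln p(X|\varphi))$ and $H(X|U,\varphi)=E(-\ln p(X|U,\varphi))$ (expectation over $X$ and $U$). Constant strategies have $I(\varphi)=0$, so $\Omega(s)$ is non-empty for every $s\ge 0$. $J_o$ is called the minimum open-loop cost. *)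

(* Defs.v *)
From HB Require Import structures.
From mathcomp Require Import all_boot all_order all_algebra.
From mathcomp Require Import all_classical all_reals all_analysis.

Set Implicit Arguments.
Unset Strict Implicit.
Unset Printing Implicit Defensive.

Import Order.TTheory GRing.Theory Num.Theory.
Import numFieldNormedType.Exports.

Local Open Scope classical_set_scope.
Local Open Scope ring_scope.

Definition measure_matrix_display : measure_display -> measure_display.
Proof. exact. Qed.

Section measurable_matrix.
Context {d} {T : measurableType d} (p q : nat).

(* Generated by the entries.  For T = R this is the Borel sigma-algebra of
   'M[R]_(p, q), which is a finite product of copies of R. *)
Definition mx_measurable : set (set 'M[T]_(p, q)) :=
  <<s [set C | exists i j, exists2 B : set T, measurable B &
         C = [set A : 'M[T]_(p, q) | B (A i j)]] >>.

Let mx_set0 : mx_measurable set0.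
Proof. exact: sigma_algebra0. Qed.

Let mx_setC A : mx_measurable A -> mx_measurable (~` A).
Proof. exact: sigma_algebraC. Qed.

Let mx_bigcup (F : _^nat) : (forall i, mx_measurable (F i)) ->
  mx_measurable (\bigcup_i (F i)).
Proof. exact: sigma_algebra_bigcup. Qed.

HB.instance Definition _ := @isMeasurable.Build (measure_matrix_display d)
  'M[T]_(p, q) mx_measurable mx_set0 mx_setC mx_bigcup.

End measurable_matrix.

Lemma measurable_fun_mx d d' (S : measurableType d) (T : measurableType d')
    (p q : nat) (g : S -> 'M[T]_(p, q)) :
  (forall i j, measurable_fun setT (fun s => g s i j)) ->
  measurable_fun setT g.
Proof.
move=> mg.
apply: (measurability
  [set C | exists i j, exists2 B : set T, measurable B &
     C = [set A : 'M[T]_(p, q) | B (A i j)]]) => //.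
move=> _ [_ [i [j [B mB ->]]] <-].
exact: (mg i j measurableT B mB).
Qed.

Lemma measurable_mx_entry d (T : measurableType d) p q i j :
  measurable_fun setT (fun A : 'M[T]_(p, q) => A i j).
Proof.
move=> _ B mB; rewrite setTI; apply: sub_sigma_algebra.
by exists i, j; exists B.
Qed.

Section pushforward_can.
Context d d' (S : measurableType d) (T : measurableType d') (R : realType).
Variables (mu : {sigma_finite_measure set S -> \bar R}) (f : S -> T) (g : T -> S).
Hypotheses (mf : measurable_fun setT f) (mg : measurable_fun setT g).
Hypothesis fK : cancel f g.

Definition pushforward_can of measurable_fun setT f & measurable_fun setT g
  & cancel f g := pushforward mu f.

Local Notation nu := (pushforward_can mf mg fK).

Let nu0 : nu set0 = 0%E. Proof. exact: measure0. Qed.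

Let nu_ge0 A : (0 <= nu A)%E. Proof. exact: measure_ge0. Qed.

Let nu_sigma_additive : semi_sigma_additive nu.
Proof.
have -> : nu = [the measure T R of measure_function.pushforward mu f].
  by [].
exact: measure_semi_sigma_additive.
Qed.

HB.instance Definition _ := isMeasure.Build _ _ _ nu
  nu0 nu_ge0 nu_sigma_additive.

Let nu_sigma_finite : sigma_finite setT nu.
Proof.
have [F FT mF] := sigma_finiteT mu.
exists (fun n => g @^-1` F n); first by rewrite -preimage_bigcup -FT.
move=> n; have [mFn Fn] := mF n; split; first by rewrite -[_ @^-1` _]setTI; exact: mg.
rewrite /pushforward_can /pushforward.
by rewrite [f @^-1` _](_ : _ = F n)//; apply/funext => x /=; rewrite fK.
Qed.

HB.instance Definition _ := Measure_isSigmaFinite.Build _ _ _ nu nu_sigma_finite.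

End pushforward_can.

(* Instance inference does not find the sigma-finite structure on m1 \x m2. *)
Section sigma_finite_product.
Context d1 d2 (T1 : measurableType d1) (T2 : measurableType d2) (R : realType).
Variables (m1 : {sigma_finite_measure set T1 -> \bar R})
  (m2 : {sigma_finite_measure set T2 -> \bar R}).

Definition sigma_finite_prod : set (T1 * T2) -> \bar R := (m1 \x m2)%E.

HB.instance Definition _ := Measure.on sigma_finite_prod.

Let sigma_finite_prod_sigma_finite : sigma_finite setT sigma_finite_prod.
Proof.
have /sigma_finiteP[F [TF ndF Foo]] := sigma_finiteT m1.
have /sigma_finiteP[G [TG ndG Goo]] := sigma_finiteT m2.
exists (fun n => F n `*` G n).
  rewrite -setXTT TF TG predeqE => -[x y]; split.
    move=> [/= [i _ Fix_] [j _ Gjy]]; exists (maxn i j) => //; split.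
    - by move: x Fix_; exact/subsetPset/ndF/leq_maxl.
    - by move: y Gjy; exact/subsetPset/ndG/leq_maxr.
  by move=> [i _ []/= ? ?]; split; exists i.
move=> k; have [? ?] := Foo k; have [? ?] := Goo k.
split; first exact: measurableX.
by rewrite /sigma_finite_prod product_measure1E// lte_mul_pinfty// ge0_fin_numE.
Qed.

HB.instance Definition _ := Measure_isSigmaFinite.Build _ _ _
  sigma_finite_prod sigma_finite_prod_sigma_finite.

End sigma_finite_product.

Section lebesgue_matrix.
Context (R : realType).

Definition cons_tuple n (x : R * n.-tuple R) : n.+1.-tuple R :=
  [the n.+1.-tuple R of x.1 :: x.2].

Definition uncons_tuple n (t : n.+1.-tuple R) : R * n.-tuple R :=
  (tnth t ord0, [tuple of behead t]).

Lemma measurable_cons_tuple n : measurable_fun setT (@cons_tuple n).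
Proof. exact: measurable_cons. Qed.

Lemma measurable_uncons_tuple n : measurable_fun setT (@uncons_tuple n).
Proof.
apply: measurable_fun_pair; first exact: measurable_tnth.
exact: measurable_behead.
Qed.

Lemma cons_tupleK n : cancel (@cons_tuple n) (@uncons_tuple n).
Proof. by case=> x t; congr pair; apply/val_inj. Qed.

Fixpoint lebesgue_tuple n : {sigma_finite_measure set (n.-tuple R) -> \bar R} :=
  match n with
  | 0 => \d_ [tuple]
  | n'.+1 =>
    pushforward_can (S := (measurableTypeR R * n'.-tuple R)%type)
      (sigma_finite_prod (@lebesgue_measure R) (lebesgue_tuple n'))
      (@measurable_cons_tuple n') (@measurable_uncons_tuple n')
      (@cons_tupleK n')
  end.

Definition mx_of_tuple p q (t : (p * q).-tuple R) : 'M[R]_(p, q) :=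
  \matrix_(i, j) tnth t (mxvec_index i j).

Definition tuple_of_mx p q (A : 'M[R]_(p, q)) : (p * q).-tuple R :=
  [tuple mxvec A 0 k | k < p * q].

Lemma measurable_mx_of_tuple p q : measurable_fun setT (@mx_of_tuple p q).
Proof.
apply: measurable_fun_mx => i j.
under eq_fun do rewrite mxE.
exact: measurable_tnth.
Qed.

Lemma measurable_tuple_of_mx p q : measurable_fun setT (@tuple_of_mx p q).
Proof.
apply/measurable_fun_tnthP => k /=.
case/mxvec_indexP: k => i j.
rewrite (_ : _ \o _ = fun A : 'M[R]_(p, q) => A i j).
  exact: measurable_mx_entry.
by apply/funext => A /=; rewrite tnth_mktuple mxvecE.
Qed.

Lemma mx_of_tupleK p q : cancel (@mx_of_tuple p q) (@tuple_of_mx p q).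
Proof.
move=> t; apply: eq_from_tnth => k; case/mxvec_indexP: k => i j.
by rewrite tnth_mktuple mxvecE mxE.
Qed.

(* Lebesgue measure on R^(p x q); p = 1 gives R^q. *)
Definition lebesgue_mx p q : {sigma_finite_measure set 'M[R]_(p, q) -> \bar R} :=
  pushforward_can (lebesgue_tuple (p * q)) (@measurable_mx_of_tuple p q)
    (@measurable_tuple_of_mx p q) (@mx_of_tupleK p q).

End lebesgue_matrix.

(* In finite dimension this is the usual class C^k: all partial derivatives up
   to order k exist and are continuous. *)
Fixpoint class_C (R : realType) (k : nat) (V W : normedModType R) (g : V -> W) :
    Prop :=
  match k with
  | 0 => continuous g
  | k'.+1 => (forall x, differentiable g x) /\
             forall v, class_C k' (fun x => 'D_v g x)
  end.

Section probability_notions.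
Context d (T : measurableType d) (R : realType) (P : probability T R).

Definition mutually_independent (I : finType) (F : I -> set (set T)) : Prop :=
  forall (K : {set I}) (E : I -> set T), (forall i, i \in K -> F i (E i)) ->
    (P (\bigcap_(i in [set` K]) E i) = \prod_(i in K) P (E i))%E.

Definition sigma_rv d' (S : measurableType d') (Z : T -> S) : set (set T) :=
  preimage_set_system setT Z measurable.

Definition has_density d' (S : measurableType d')
    (mu : {measure set S -> \bar R}) (Z : T -> S) (p : S -> R) : Prop :=
  [/\ measurable_fun setT p, forall z, 0 <= p z &
      forall A, measurable A ->
        (P (Z @^-1` A) = \int[mu]_(z in A) (p z)%:E)%E].

(* [q z y] is the conditional density of Z at z given Y = y; the law of Y is
   arbitrary (it may be discrete). *)
Definition has_cond_density d1 d2 (S1 : measurableType d1)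
    (S2 : measurableType d2) (mu : {measure set S1 -> \bar R})
    (Z : T -> S1) (Y : T -> S2) (q : S1 -> S2 -> R) : Prop :=
  [/\ measurable_fun setT (fun zy : S1 * S2 => q zy.1 zy.2),
      forall z y, 0 <= q z y &
      forall A B, measurable A -> measurable B ->
        (P (Z @^-1` A `&` Y @^-1` B) =
         \int[P]_(t in Y @^-1` B) \int[mu]_(z in A) (q z (Y t))%:E)%E].

Definition entropy S (Z : T -> S) (p : S -> R) : R :=
  fine 'E_P[fun t => - ln (p (Z t))].

Definition cond_entropy S1 S2 (Z : T -> S1) (Y : T -> S2) (q : S1 -> S2 -> R) :
    R :=
  fine 'E_P[fun t => - ln (q (Z t) (Y t))].

Definition finite_entropy S (Z : T -> S) (p : S -> R) : Prop :=
  P.-integrable setT (fun t => (- ln (p (Z t)))%:E).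

Definition finite_cond_entropy S1 S2 (Z : T -> S1) (Y : T -> S2)
    (q : S1 -> S2 -> R) : Prop :=
  P.-integrable setT (fun t => (- ln (q (Z t) (Y t)))%:E).

End probability_notions.

Definition control_set (R : realType) r (Uad : set 'rV[R]_r) : Prop :=
  (exists umin umax : 'rV[R]_r,
     Uad = [set u | forall j, umin 0 j <= u 0 j <= umax 0 j]) \/ Uad = setT.

Section noise.
Context d (T : measurableType d) (R : realType) (P : probability T R).
Context (n nw nv : nat).
Context (x0 : T -> 'rV[R]_n) (w : nat -> T -> 'rV[R]_nw)
  (v : nat -> T -> 'rV[R]_nv).

Definition noise_independent (k : nat) : Prop :=
  mutually_independent P (fun i : option ('I_k.+1 + 'I_k.+1) =>
    match i with
    | None => sigma_rv x0
    | Some (inl j) => sigma_rv (w j)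
    | Some (inr j) => sigma_rv (v j)
    end).

End noise.

(* col(a_0, ..., a_{N-1}), with a_k in R^q, is the N x q matrix with rows a_k. *)
Section strategies.
Context (R : realType) (N m r : nat).

Definition strategy := 'M[R]_(N, m) -> 'M[R]_(N, r).

(* Y_k = col(y_0, ..., y_k) *)
Definition past (Y : 'M[R]_(N, m)) (k : 'I_N) : 'M[R]_(k.+1, m) :=
  \matrix_(i, j) Y (widen_ord (ltn_ord k) i) j.

(* Boundedness is automatic when Uad is a box; it matters when Uad = R^r. *)
Definition admissible (Uad : set 'rV[R]_r) : set strategy :=
  [set phi | (exists g : forall k : 'I_N, 'M[R]_(k.+1, m) -> 'rV[R]_r,
                [/\ forall k, measurable_fun setT (g k),
                    forall k Yk, Uad (g k Yk) &
                    forall Y k, row k (phi Y) = g k (past Y k)]) /\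
             bounded_fun phi].

End strategies.

Section closed_loop.
Context (R : realType) (T : Type) (N n m r nw nv : nat).
Context (f : 'rV[R]_n * 'rV[R]_r * 'rV[R]_nw -> 'rV[R]_n)
        (h : 'rV[R]_n * 'rV[R]_nv -> 'rV[R]_m)
        (x0 : T -> 'rV[R]_n) (w : nat -> T -> 'rV[R]_nw)
        (v : nat -> T -> 'rV[R]_nv).

Definition set_row (k : nat) (y : 'rV[R]_m) (Y : 'M[R]_(N, m)) : 'M[R]_(N, m) :=
  \matrix_(i, j) if i == k :> nat then y 0 j else Y i j.

Definition control_at (U : 'M[R]_(N, r)) (k : nat) : 'rV[R]_r :=
  if insub k is Some i then row i U else 0.

(* [loop phi k t] is x_k together with col(y_0, ..., y_{k-1}, 0, ..., 0).  Row k
   of phi Y depends on y_0, ..., y_k only when phi is admissible, so padding by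
   0 the outputs not yet observed does not affect u_k = phi_k(Y_k). *)
Fixpoint loop (phi : strategy R N m r) (k : nat) (t : T) :
    'rV[R]_n * 'M[R]_(N, m) :=
  match k with
  | 0 => (x0 t, 0)
  | k'.+1 =>
    let: (x, Y) := loop phi k' t in
    let Y' := set_row k' (h (x, v k' t)) Y in
    (f (x, control_at (phi Y') k', w k' t), Y')
  end.

Definition state (phi : strategy R N m r) k t : 'rV[R]_n := (loop phi k t).1.

Definition output (phi : strategy R N m r) k t : 'rV[R]_m :=
  h (state phi k t, v k t).

Definition stateX (phi : strategy R N m r) t : 'M[R]_(N, n) :=
  \matrix_(k < N) state phi k t.

Definition outputY (phi : strategy R N m r) t : 'M[R]_(N, m) :=
  \matrix_(k < N) output phi k t.

Definition controlU (phi : strategy R N m r) t : 'M[R]_(N, r) :=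
  phi (outputY phi t).

End closed_loop.

Section cost_information.
Context d (T : measurableType d) (R : realType) (P : probability T R).
Context (N n m r nw nv : nat).
Context (f : 'rV[R]_n * 'rV[R]_r * 'rV[R]_nw -> 'rV[R]_n)
        (h : 'rV[R]_n * 'rV[R]_nv -> 'rV[R]_m)
        (x0 : T -> 'rV[R]_n) (w : nat -> T -> 'rV[R]_nw)
        (v : nat -> T -> 'rV[R]_nv) (L : 'rV[R]_n -> R).

(* [fine] is harmless under [finite_cost]; likewise for the entropies under
   [finite_entropy] and [finite_cond_entropy]. *)
Definition cost (phi : strategy R N m r) : R :=
  fine 'E_P[fun t => L (state f h x0 w v phi N t)].

Definition finite_cost (phi : strategy R N m r) : Prop :=
  P.-integrable setT (fun t => (L (state f h x0 w v phi N t))%:E).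

(* pX phi = p(. | phi) and pXU phi = p(. | ., phi) *)
Context (pX : strategy R N m r -> 'M[R]_(N, n) -> R)
        (pXU : strategy R N m r -> 'M[R]_(N, n) -> 'M[R]_(N, r) -> R).

(* The densities of X and of X given U under phi exist, and the entropies
   H(X|phi) and H(X|U,phi) are finite. *)
Definition information_densities (phi : strategy R N m r) : Prop :=
  let X := stateX f h x0 w v phi in
  let U := controlU f h x0 w v phi in
  [/\ has_density P (lebesgue_mx R N n) X (pX phi),
      has_cond_density P (lebesgue_mx R N n) X U (pXU phi),
      finite_entropy P X (pX phi) &
      finite_cond_entropy P X U (pXU phi)].

Definition information (phi : strategy R N m r) : R :=
  let X := stateX f h x0 w v phi in
  let U := controlU f h x0 w v phi in
  entropy P X (pX phi) - cond_entropy P X U (pXU phi).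

Definition information_limited (Uad : set 'rV[R]_r) (s : R) :
    set (strategy R N m r) :=
  admissible Uad `&` [set phi | information phi <= s].

End cost_information.

Definition minimizer (R : realType) (S : Type) (J : S -> R) (A : set S) (a : S) :
    Prop :=
  A a /\ forall b, A b -> J a <= J b.

(* Main.v *)
(* Take rho s := Jo - inf J over Omega(s).  Omega(s) increases with s, J is
   bounded below by J(phistar), and phi always lies in Omega(I(phi)), whatever
   the sign of I(phi). *)

Require Import Defs.
From HB Require Import structures.
From mathcomp Require Import all_boot all_order all_algebra.
From mathcomp Require Import all_classical all_reals all_analysis.

Set Implicit Arguments.
Unset Strict Implicit.
Unset Printing Implicit Defensive.

Import Order.TTheory GRing.Theory Num.Theory.
Import numFieldNormedType.Exports.

Local Open Scope classical_set_scope.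
Local Open Scope ring_scope.

(** The gain [rho s] is the most that a strategy using at most [s] units of information can save
    over the open-loop optimum. Relaxing the information budget enlarges the feasible set, so its
    infimal cost can only drop ([le_inf_image]), yet never below [Jstar]. The estimate is then
    tautological: each strategy competes in the problem whose budget is its own information. *)

(** The side conditions keep both infima genuine, since [inf] on the reals is 0 by default on sets
    that are empty or unbounded below. *)
Lemma le_inf_image (R : realType) (S : Type) (J : S -> R) (A B : set S) :
  has_lbound (J @` B) -> A !=set0 -> A `<=` B -> inf (J @` B) <= inf (J @` A).
Proof.
move=> lbB [a Aa] AB; apply: lb_le_inf; first by exists (J a), a.
by move=> _ [b Ab <-]; apply: ge_inf => //; exists b => //; exact: AB.
Qed.

Theorem lemma1
  (d : measure_display) (T : measurableType d) (R : realType)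
  (P : probability T R)
  (N n m r nw nv : nat) (hN : (0 < N)%N)
  (f : 'rV[R]_n * 'rV[R]_r * 'rV[R]_nw -> 'rV[R]_n)
  (h : 'rV[R]_n * 'rV[R]_nv -> 'rV[R]_m)
  (Uad : set 'rV[R]_r)
  (L : 'rV[R]_n -> R)
  (hf : class_C 2 f) (hh : class_C 2 h)
  (hU : control_set Uad)
  (hLm : measurable_fun setT L) (hL : class_C 2 L)
  (x0 : {RV P >-> 'rV[R]_n})
  (w : nat -> {RV P >-> 'rV[R]_nw})
  (v : nat -> {RV P >-> 'rV[R]_nv})
  (p0 : 'rV[R]_n -> R) (pw : 'rV[R]_nw -> R) (pv : 'rV[R]_nv -> R)
  (hx0 : has_density P (lebesgue_mx R 1 n) x0 p0)
  (hw : forall k, has_density P (lebesgue_mx R 1 nw) (w k) pw)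
  (hv : forall k, has_density P (lebesgue_mx R 1 nv) (v k) pv)
  (hindep : forall k, noise_independent P x0 w v k)
  (pX : strategy R N m r -> 'M[R]_(N, n) -> R)
  (pXU : strategy R N m r -> 'M[R]_(N, n) -> 'M[R]_(N, r) -> R)
  (hJ : forall phi : strategy R N m r, admissible Uad phi ->
     finite_cost P f h x0 w v L phi)
  (hI : forall phi : strategy R N m r, admissible Uad phi ->
     information_densities P f h x0 w v pX pXU phi) :
  let S_ad : set (strategy R N m r) := admissible Uad in
  let J : strategy R N m r -> R := cost P f h x0 w v L in
  let I : strategy R N m r -> R := information P f h x0 w v pX pXU in
  let Omega : R -> set (strategy R N m r) :=
    information_limited P f h x0 w v pX pXU Uad in
  forall phistar : strategy R N m r,
  minimizer J S_ad phistar ->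
  (forall s : R, 0 <= s -> exists phi, minimizer J (Omega s) phi) ->
  let Jo := inf [set J phi | phi in Omega 0] in
  let Jstar := J phistar in
  exists rho : R -> R,
    [/\ forall s1 s2 : R, 0 <= s1 -> s1 <= s2 -> rho s1 <= rho s2,
        [bounded rho s | s in [set s : R | 0 <= s]],
        forall s : R, 0 <= s -> 0 <= rho s <= Jo - Jstar,
        rho 0 = 0 &
        forall phi, S_ad phi -> Jo - J phi <= rho (I phi)].
Proof.
move=> S_ad J I Omega phistar [_ Jmin] Omega_min Jo Jstar.
(* Stated for every real [s], because the last step takes [s] to be [I phi], whose sign is not
   known. *)
have lbJ s : lbound (J @` Omega s) Jstar by move=> _ [phi [+ _] <-]; exact: Jmin.
have blJ s : has_lbound (J @` Omega s) by exists Jstar; exact: lbJ.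
have Omega0 s : 0 <= s -> Omega s !=set0.
  by move=> /Omega_min[phi [Ophi _]]; exists phi.
pose rho s := Jo - inf (J @` Omega s).
have rho_le s1 s2 : 0 <= s1 -> s1 <= s2 -> rho s1 <= rho s2.
  move=> s1_ge0 s12; rewrite lerD2l lerN2.
  apply: le_inf_image; [exact: blJ|exact: Omega0|].
  by move=> phi [adm I1]; split=> //=; exact: le_trans s12.
have rho0 : rho 0 = 0 by exact: subrr.
have rho_itv s : 0 <= s -> 0 <= rho s <= Jo - Jstar.
  (* The lower bound 0 is read as [rho 0], so monotonicity gives it; the upper bound is [lbJ]. *)
  move=> s_ge0; rewrite -{1}rho0 rho_le//= lerD2l lerN2.
  by apply: lb_le_inf (lbJ s); exact/image_nonempty/Omega0.
exists rho; split=> //.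
  exists (Jo - Jstar); split; first exact: num_real.
  move=> M ltM s /rho_itv/andP[rho_ge0 rho_leJ].
  by rewrite /= ger0_norm// (le_trans rho_leJ)// ltW.
move=> phi adm; rewrite lerD2l lerN2.
(* Membership of [phi] in [Omega (I phi)] is reflexivity of the order. *)
by apply: ge_inf => //; exists phi => //; split=> /=.
Qed.
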